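(* There is a function $f:(0,1]\times\mathbb{N}\to[1,\infty)$ such that the following holds: for all $\rho\in(0,1]$ and $C\in\mathbb{N}$, if $P\le\mathrm{Sym}(\Omega)$ is a permutation group of finite degree such that $|\mathrm{SB}_C(P)|\ge\rho|P|$, then $|P|\le f(\rho,C)$. Indeed, one may choose $$f(\rho,C):=\left(\lfloor\rho^{-1}+C+1\rfloor!\right)^{\lceil 8(C-\log\rho)\rceil}.$$
   Context: $\mathbb{N}$ includes $0$, and $\log$ is the natural logarithm. The degree of $P\le\mathrm{Sym}(\Omega)$ is $|\Omega|$. For $C\in\mathbb{N}$, $\mathrm{SB}_C(P)$ denotes the set of all $\sigma\in P$ that move at most $C$ points of $\Omega$. *)

(* Defs.v *)
From mathcomp Require Import all_boot all_order all_algebra all_fingroup.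
From mathcomp Require Import all_classical all_reals all_analysis.

Set Implicit Arguments.
Unset Strict Implicit.
Unset Printing Implicit Defensive.

Import Order.TTheory GRing.Theory Num.Theory.
Local Open Scope ring_scope.

Definition moved (T : finType) (s : {perm T}) : {set T} := [set x | s x != x].

Definition SB (T : finType) (C : nat) (P : {set {perm T}}) : {set {perm T}} :=
  [set s in P | (#|moved s| <= C)%N].

Definition is_order_bound (R : realType) (f : R -> nat -> R) : Prop :=
  (forall (rho : R) (C : nat), 0 < rho <= 1 -> 1 <= f rho C) /\
  (forall (rho : R) (C : nat), 0 < rho <= 1 ->
     forall (T : finType) (P : {group {perm T}}),
       rho * #|P|%:R <= #|SB C P|%:R -> #|P|%:R <= f rho C).

(* [Num.truncn] is the floor on nonnegative arguments, [ln] the natural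
   logarithm, and the outer [^] is exponentiation with an [int] exponent. *)
Definition explicit_bound (R : realType) (rho : R) (C : nat) : R :=
  ((Num.truncn (rho^-1 + C%:R + 1))`!)%:R ^ Num.ceil (8 * (C%:R - ln rho)).

(* Main.v *)
(** Burnside's lemma on one orbit bounds orbit lengths by [1 / rho + C].
    Choose orbits one at a time, each moved by the pointwise stabilizer of the
    previous ones, until [P] acts faithfully on their union; then [|P|] is at
    most [N!^m] for [m] orbits of length at most [N].  The number of chosen
    orbits moved by a random element of [P] dominates a binomial [Bin(m, 1/2)]:
    the mean of [2^-(number of moved orbits)] is at most [(3/4)^m].  An element
    of [SB C P] moves at most [C] of the disjoint orbits, so
    [rho 2^-C <= (3/4)^m], which bounds [m]. *)
Require Import Defs.
From mathcomp Require Import all_boot all_order all_algebra all_fingroup.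
From mathcomp Require Import all_classical all_reals all_analysis.
From mathcomp Require Import fintype finset lra.

Set Implicit Arguments.
Unset Strict Implicit.
Unset Printing Implicit Defensive.

Import Order.TTheory GRing.Theory Num.Theory.
Local Open Scope ring_scope.

(** Moved means not fixed pointwise: an orbit that [s] permutes nontrivially counts, although [s]
    preserves it as a set. *)
Definition moved_sets (T : finType) (Q : {set {set T}}) (s : {perm T}) :
    {set {set T}} :=
  [set O in Q | s \notin 'C(O | 'P)%g].

Lemma in_moved_sets (T : finType) (Q : {set {set T}}) (s : {perm T})
    (O : {set T}) :
  (O \in moved_sets Q s) = (O \in Q) && (s \notin 'C(O | 'P)%g).
Proof. by rewrite in_set. Qed.

Lemma moved_sets_setU1 (T : finType) (Q : {set {set T}}) (O : {set T})
    (s : {perm T}) :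
  O \notin Q ->
  #|moved_sets (O |: Q) s| = ((s \notin 'C(O | 'P)%g) + #|moved_sets Q s|)%N.
Proof.
move=> OQ; case: (boolP (s \in _)) => sO /=.
  rewrite add0n; apply: eq_card => B; rewrite !in_moved_sets in_setU1.
  by case: eqP => [->|//]; rewrite sO !andbF.
have -> : moved_sets (O |: Q) s = O |: moved_sets Q s.
  apply/setP=> B; rewrite in_setU1 !in_moved_sets in_setU1.
  by case: eqP => [->|//]; rewrite sO.
by rewrite cardsU1 in_moved_sets (negPf OQ).
Qed.

Lemma moved_setsM (T : finType) (Q : {set {set T}}) (s k : {perm T}) :
  k \in 'C(cover Q | 'P)%g -> moved_sets Q (s * k)%g = moved_sets Q s.
Proof.
move=> kQ; apply/setP=> B; rewrite !in_moved_sets.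
case: (boolP (B \in Q)) => //= BQ.
by rewrite groupMr // (subsetP (astabS _ (bigcup_sup B _)) _ kQ).
Qed.

(** A moved orbit contains a moved point, and a point determines its orbit. *)
Lemma leq_card_moved_sets (T : finType) (P : {group {perm T}})
    (Q : {set {set T}}) (s : {perm T}) :
  Q \subset orbit 'P P @: [set: T] -> (#|moved_sets Q s| <= #|moved s|)%N.
Proof.
move=> sQ; apply: leq_trans (leq_imset_card (orbit 'P P) (mem (moved s))).
apply/subset_leq_card/subsetP => O; rewrite in_moved_sets => /andP[OQ sO].
have [y _ defO] := imsetP (subsetP sQ O OQ).
have [x xO sx] : exists2 x, x \in O & s x != x.
  apply/exists_inP; apply: contraNT sO => /exists_inPn sfix.
  by apply/astabP => x /sfix /negPn/eqP.
apply/imsetP; exists x; first by rewrite inE.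
by rewrite defO; apply/eqP; rewrite eq_sym orbit_eq_mem -defO.
Qed.

(* Pairing [s] with [s * k]: they have the same weight on [Q], and at most one
   of them fixes [O] pointwise, so [O] contributes an average factor of at most
   [(1 + 1/2) / 2]. *)
Lemma sum_moved_sets_step (R : realFieldType) (T : finType)
    (P : {group {perm T}}) (Q : {set {set T}}) (O : {set T}) (k : {perm T}) :
  O \notin Q -> k \in P -> k \in 'C(cover Q | 'P)%g ->
  k \notin 'C(O | 'P)%g ->
  \sum_(s in P) (2^-1 : R) ^+ #|moved_sets (O |: Q) s| <=
    3 / 4 * \sum_(s in P) (2^-1 : R) ^+ #|moved_sets Q s|.
Proof.
move=> OQ kP kQ kO.
set S := \sum_(s in P) _.
pose c (s : {perm T}) : R := 2^-1 ^+ (s \notin 'C(O | 'P)%g).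
have defS : S = \sum_(s in P) 2^-1 ^+ #|moved_sets Q s| * c s.
  by apply: eq_bigr => s _; rewrite moved_sets_setU1 // exprD mulrC.
have defSk : S = \sum_(s in P) 2^-1 ^+ #|moved_sets Q s| * c (s * k)%g.
  rewrite defS (reindex_inj (mulIg k)) /=.
  by apply: eq_big => [s|s _]; rewrite ?groupMr // moved_setsM.
suff : S + S <= 3 / 2 * \sum_(s in P) 2^-1 ^+ #|moved_sets Q s| by lra.
rewrite {1}defS defSk -big_split mulr_sumr; apply: ler_sum => s _ /=.
rewrite -mulrDr mulrC; apply: ler_wpM2r; first by rewrite exprn_ge0.
rewrite /c; case: (boolP (s \in _)) => sO; last first.
  by case: (_ \notin _); rewrite ?expr0 ?expr1; lra.
by rewrite groupMl // kO expr0 expr1; lra.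
Qed.

(** Restriction to [O] maps [K] into the symmetric group on [O], with the pointwise stabilizer as
    kernel. *)
Lemma leq_card_astab_fact (T : finType) (K : {group {perm T}})
    (O : {set T}) :
  [acts K, on O | 'P] -> (#|K| <= #|'C_K(O | 'P)%g| * #|O| `!)%N.
Proof.
move=> actO; rewrite -(Lagrange (subsetIl K 'C(O | 'P)%g)) leq_mul2l.
apply/orP; right; rewrite indexgI /= -ker_restr_perm.
rewrite -{1}(setIidPr actO) -card_morphim -card_Sym.
apply/subset_leq_card/subsetP => _ /morphimP[s _ _ ->].
by rewrite inE restr_perm_on.
Qed.

(* Orbits are added greedily until their pointwise stabilizer in [P] is
   trivial; each new orbit is moved by the current stabilizer. *)
Lemma exists_independent_orbits (R : realFieldType) (T : finType)
    (P : {group {perm T}}) (N : nat) :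
  (forall x, #|orbit 'P P x| <= N)%N ->
  exists Q : {set {set T}},
    [/\ Q \subset orbit 'P P @: [set: T], (#|P| <= N`! ^ #|Q|)%N &
        \sum_(s in P) (2^-1 : R) ^+ #|moved_sets Q s| <=
          (3 / 4) ^+ #|Q| * #|P|%:R].
Proof.
move=> leN.
pose stab (Q : {set {set T}}) := 'C_P(cover Q | 'P)%g.
(* The order bound keeps the factor [#|stab Q|], which becomes 1 once the stabilizer is trivial. *)
pose good (Q : {set {set T}}) := [&& Q \subset orbit 'P P @: [set: T],
  (#|P| <= #|stab Q| * N`! ^ #|Q|)%N &
  \sum_(s in P) (2^-1 : R) ^+ #|moved_sets Q s| <=
          (3 / 4) ^+ #|Q| * #|P|%:R].
have good0 : good set0.
  rewrite /good sub0set cards0 expn0 muln1 mul1r /stab /cover big_set0.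
  rewrite (setIidPl _) ?leqnn /=; last first.
    by apply/subsetP => s _; apply/astabP => x; rewrite inE.
  rewrite -sumr_const; apply: ler_sum => s _; rewrite exprn_ile1 //; lra.
(* A good [Q] of maximal size replaces the iteration: a nontrivial [k] in [stab Q] moves some [x],
   and adding the orbit of [x] gives a larger good set. *)
have [Q /and3P[Qorb cardQ sumQ] maxQ] := arg_maxnP (fun Q : {set {set T}} => #|Q|) good0.
have [/trivgP triv|] := boolP (stab Q \subset [1 {perm T}]%g).
  by exists Q; split=> //; rewrite /stab triv cards1 mul1n in cardQ.
case/fintype.subsetPn => k kQ; rewrite inE => k1; exfalso.
have [kP kC] := setIP kQ.
have [x kx] : exists x, k x != x.
  apply/existsP; apply: contraNT k1 => /existsPn kfix.
  by apply/eqP/permP => y; rewrite perm1; apply/eqP/negPn.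
pose O := orbit 'P P x.
have kO : k \notin 'C(O | 'P)%g.
  apply: contra kx => kO; apply/eqP; exact: (astab_act kO (orbit_refl _ _ x)).
have OQ : O \notin Q.
  apply: contra kO => OQ.
  by rewrite (subsetP (astabS _ (bigcup_sup O _)) _ kC).
suff /maxQ : good (O |: Q) by rewrite cardsU1 OQ /= ltnn.
apply/and3P; split.
- by rewrite subUset Qorb sub1set imset_f.
- apply: leq_trans cardQ _; rewrite cardsU1 OQ expnS mulnA leq_mul2r.
  apply/orP; right.
  have actO : [acts stab Q, on O | 'P].
    by apply: subset_trans (acts_orbit _ _ (subsetT P)); apply: subsetIl.
  apply: leq_trans (leq_card_astab_fact actO) _.
  rewrite /stab /cover bigcup_setU big_set1 astabU.
  rewrite -setIA [X in P :&: X]setIC; apply: leq_mul => //.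
  exact/leq_fact/leN.
- have step := sum_moved_sets_step R OQ kP kC kO; apply: (le_trans step).
  rewrite cardsU1 OQ exprD expr1 -[leRHS]mulrA; apply: ler_wpM2l => //; lra.
Qed.

(** On the single orbit [O], Burnside's lemma says that the fixed-point counts of the elements of
    [P] sum to [#|P|]. Each element of [SB C P] contributes at least [#|O| - C]. *)
Lemma orbit_SB_bound (R : realFieldType) (T : finType) (C : nat)
    (P : {group {perm T}}) (rho : R) (x : T) :
  0 < rho -> rho * #|P|%:R <= #|SB C P|%:R ->
  #|orbit 'P P x|%:R <= rho^-1 + C%:R.
Proof.
move=> rho0 dens; set O := orbit 'P P x.
have P0 : 0 < #|P|%:R :> R by rewrite ltr0n cardG_gt0.
have actO : [acts P, on O | 'P] by apply: acts_orbit; apply: subsetT.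
have := Frobenius_Cauchy actO.
have -> : [set orbit 'P P y | y in O] = [set O].
  apply/setP=> B; rewrite inE; apply/imsetP/eqP => [[y yO ->]|->].
    by apply/eqP; rewrite orbit_eq_mem.
  by exists x; rewrite // orbit_refl.
rewrite cards1 mul1n => burnside.
have lb : (#|SB C P| * (#|O| - C) <= #|P|)%N.
  rewrite -burnside -sum_nat_const [X in (_ <= X)%N](bigID [in SB C P]) /=.
  apply: leq_trans (leq_addr _ _).
  rewrite [X in (_ <= X)%N](eq_bigl [in SB C P]); last first.
    by move=> s; rewrite !inE; case: (s \in P).
  apply: leq_sum => s; rewrite inE => /andP[_ sC].
  rewrite leq_subLR; apply: leq_trans (leq_add sC (leqnn _)).
  apply: leq_trans (leq_card_setU _ _).
  apply/subset_leq_card/subsetP => y yO; rewrite !inE yO /=.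
  by rewrite sub1set inE; case: (s y =P y) => //= ->.
(* The subtraction in [lb] is truncated, so it transfers to [R] only when [C < #|O|]. *)
have [leOC|ltCO] := leqP #|O| C.
  by apply: ler_wpDl; rewrite ?ler_nat // invr_ge0 ltW.
rewrite -lerBlDr -natrB 1?ltnW // -[rho^-1]mul1r ler_pdivlMr //.
rewrite -(ler_pM2r P0) mul1r -mulrA.
apply: le_trans (ler_wpM2l _ dens) _ => //.
by rewrite -natrM ler_nat mulnC.
Qed.

(** Each element of [SB C P] moves at most [C] orbits, so its term is at least [2^-C]; the other
    terms are nonnegative. *)
Lemma SB_density_bound (R : realFieldType) (T : finType) (C : nat)
    (P : {group {perm T}}) (Q : {set {set T}}) :
  Q \subset orbit 'P P @: [set: T] ->
  (2^-1 : R) ^+ C * #|SB C P|%:R <=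
    \sum_(s in P) 2^-1 ^+ #|moved_sets Q s|.
Proof.
move=> Qorb; rewrite mulr_natr -sumr_const.
rewrite [X in _ <= X](bigID [in SB C P]) /=.
apply: ler_wpDr; first by apply: sumr_ge0 => s _; rewrite exprn_ge0.
rewrite [X in _ <= X](eq_bigl [in SB C P]); last first.
  by move=> s; rewrite !inE; case: (s \in P).
apply: ler_sum => s; rewrite inE => /andP[_ sC].
apply: ler_wiXn2l; [lra | lra |].
exact: leq_trans (leq_card_moved_sets s Qorb) sC.
Qed.

Lemma num_orbits_bound (R : realType) (m C : nat) (rho : R) :
  0 < rho -> 2^-1 ^+ C * rho <= (3 / 4) ^+ m ->
  m%:R <= 8 * (C%:R - ln rho).
Proof.
move=> rho0 le.
have /ler_ln : 2^-1 ^+ C * rho \is Num.pos.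
  by rewrite posrE mulr_gt0 // exprn_gt0.
move=> /(_ ((3 / 4) ^+ m)) => h; move: le; rewrite -h ?posrE ?exprn_gt0 //.
rewrite lnM ?posrE ?exprn_gt0 // !lnXn ?divr_gt0 //.
rewrite lnV ?posrE //.
have : ln (2 : R) <= 1.
  by have := @le_ln1Dx R 1; rewrite -natr1 addrC; apply; lra.
have : ln (3 / 4 : R) <= - (1 / 4).
  have -> : 3 / 4 = 1 + - (1 / 4) :> R by lra.
  by apply: le_ln1Dx; lra.
move=> l34 l2; rewrite -[_ *+ C]mulr_natr -[_ *+ m]mulr_natr.
have m0 : 0 <= m%:R :> R by [].
have C0 : 0 <= C%:R :> R by [].
have := ler_wpM2r m0 l34; have := ler_wpM2r C0 l2.
set a := ln 2 * _; set b := ln (3 / 4) * _.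
(* With [ln 2 <= 1] and [ln (3 / 4) <= - (1 / 4)], taking logarithms gives [m / 4 <= C - ln rho].
   The right side is thus nonnegative, and the factor 4 may be relaxed to 8. *)
rewrite !mulNr -/a; lra.
Qed.

Lemma explicit_bound_ge1 (R : realType) (rho : R) (C : nat) :
  0 < rho <= 1 -> 1 <= explicit_bound rho C.
Proof.
move=> /andP[rho0 rho1]; rewrite /explicit_bound.
(* A nonnegative exponent makes the integer power an ordinary power of a factorial rather than an
   inverse. *)
have : 0 <= Num.ceil (8 * (C%:R - ln rho)).
  rewrite ceil_ge0 (lt_le_trans (_ : -1 < 0)) ?ltrN10 // mulr_ge0 //.
  by rewrite subr_ge0 (le_trans (ln_le0 rho1)).
case: (Num.ceil _) => // n _.
by rewrite -exprnP exprn_ege1 // ler1n fact_gt0.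
Qed.

Lemma explicit_bound_correct (R : realType) (rho : R) (C : nat) (T : finType)
    (P : {group {perm T}}) :
  0 < rho <= 1 -> rho * #|P|%:R <= #|SB C P|%:R ->
  #|P|%:R <= explicit_bound rho C.
Proof.
move=> /andP[rho0 rho1] dens; rewrite /explicit_bound.
set N := Num.truncn _.
have leN x : (#|orbit 'P P x| <= N)%N.
  have le := orbit_SB_bound x rho0 dens.
  have iv0 : 0 <= rho^-1 by rewrite invr_ge0 ltW.
  have C0 : 0 <= C%:R :> R by [].
  rewrite truncn_ge_nat; lra.
have [Q [Qorb cardP sumQ]] := exists_independent_orbits R leN.
have P0 : 0 < #|P|%:R :> R by rewrite ltr0n cardG_gt0.
have leQ : #|Q|%:R <= 8 * (C%:R - ln rho).
  (* After multiplication by [#|P|], the density hypothesis bounds the left side by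
     [2^-C * #|SB C P|], hence by the weight sum. *)
  apply: num_orbits_bound => //; rewrite -(ler_pM2r P0) -mulrA.
  apply: le_trans sumQ; apply: le_trans (SB_density_bound R C Qorb).
  by apply: ler_wpM2l dens; rewrite exprn_ge0.
have : (#|Q|%:Z <= Num.ceil (8 * (C%:R - ln rho)) :> int).
  by rewrite -(ler_int R); apply: le_trans leQ (ceil_ge _).
case: (Num.ceil _) => // n; rewrite lez_nat => leQn.
rewrite -exprnP -natrX ler_nat; apply: leq_trans cardP _.
by rewrite leq_pexp2l // fact_gt0.
Qed.

Theorem theorem3p2 (R : realType) :
  (exists f : R -> nat -> R, is_order_bound f) /\
  is_order_bound (@explicit_bound R).
Proof.
have bound : is_order_bound (@explicit_bound R).
  split=> [rho C|rho C rho01 T P]; first exact: explicit_bound_ge1.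
  exact: explicit_bound_correct.
by split=> //; exists (@explicit_bound R).
Qed.
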